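(* Let $n\ge3$ and let $X=(X_1,\ldots,X_n)\in\{-1,1\}^n$ be distributed according to the stationary distribution of the anti-voter model on the complete graph with $n$ vertices. Let $U=\sum_{i=1}^n X_i$, $\sigma^2=\operatorname{Var}(U)$ and $W=U/\sigma$. Then $$\frac{P(W\ge x)}{1-\Phi(x)}=1+O(1)(1+x^3)/\sqrt n$$ for $0\le x\le n^{1/6}$.
   Context: $\Phi$ is the standard normal distribution function. The (discrete time) anti-voter model on the complete graph with vertex set $\{1,\ldots,n\}$ is the following Markov chain on $\{-1,1\}^n$: in each step, pick a vertex $I$ uniformly at random and then uniformly pick an edge connecting it to another vertex $J$ (so $J$ is uniform on the vertices other than $I$), and change $X_I$ to $-X_J$. $O(1)$ denotes a quantity whose absolute value is bounded by an absolute constant (independent of $n$ and $x$). *)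

(* Defs.v *)
From HB Require Import structures.
From mathcomp Require Import all_boot all_order all_algebra.
From mathcomp Require Import all_classical all_reals all_analysis.
Import Order.TTheory GRing.Theory Num.Theory.
Import numFieldNormedType.Exports.

Set Implicit Arguments.
Unset Strict Implicit.
Unset Printing Implicit Defensive.

Local Open Scope classical_set_scope.
Local Open Scope ring_scope.

(* A configuration in {-1,1}^n is encoded as an n-tuple of booleans
   (true for 1, false for -1), so that the configuration space is both a
   finite type and a measurable type; [spin] recovers the value in {-1,1}. *)
Definition spin (R : realType) (b : bool) : R := if b then 1 else -1.

(* X_i := - X_j *)
Definition antivoter_move (n : nat) (s : n.-tuple bool) (i j : 'I_n) :
    n.-tuple bool :=
  [tuple if k == i then ~~ tnth s j else tnth s k | k < n].

(* I is uniform on the n vertices and, given I = i, J is uniform on the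
   n - 1 vertices other than i. *)
Definition antivoter_transition (R : realType) (n : nat)
    (s t : n.-tuple bool) : R :=
  \sum_(i < n) n%:R^-1 *
    \sum_(j < n | j != i) n.-1%:R^-1 * (antivoter_move s i j == t)%:R.

Definition antivoter_stationary (R : realType) (n : nat)
    (p : n.-tuple bool -> R) : Prop :=
  [/\ forall s, 0 <= p s,
      \sum_s p s = 1
    & forall t, \sum_s p s * antivoter_transition R s t = p t].

(* Phi, the standard normal distribution function *)
Definition std_normal_cdf (R : realType) (x : R) : R :=
  fine (normal_prob 0 1 `]-oo, x]).

(* Main.v *)
Require Import Defs.
From HB Require Import structures.
From mathcomp Require Import all_boot all_order all_algebra.
From mathcomp Require Import all_classical all_reals all_analysis measurable_realfun.
From mathcomp Require Import ring lra zify.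
Import Order.TTheory GRing.Theory Num.Theory.
Import numFieldNormedType.Exports.

(** Let K be the number of +1 spins, so that U = 2K - n.  On the complete graph
    K is itself a birth-death chain: it moves up when both chosen spins are -1
    and down when both are +1.  Stationarity therefore forces detailed balance,
      P(K = k) (n-k)(n-k-1) = P(K = k+1) (k+1) k     ([plus_law_balance]),
    whose solution is proportional to C(n,k)^2 k (n-k); hence the law is
    symmetric ([plus_law_sym]).  Stationarity applied to U^2 gives
    Var U = n(n-2)/(2n-3), which is n/2 up to a factor 1 - 1/(2n-3).

    Write u = 2k - n, a = (u+2)/n and b = u/n.  Detailed balance says that the
    ratio of consecutive weights is (1-a)(1-b)/((1+a)(1+b)), and
      2a <= ln((1+a)/(1-a)) <= 2a + 2a^3.
    Summing over k from the middle outwards, the weight at u is, relative to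
    the middle one, at most about exp(-u^2/n) everywhere ([weight_le]), and at
    least exp(-u^2/n - u^4/n^3) in the bulk ([weight_ge]).  With
    tau = sqrt(n/2) and t = u/tau these are values of the normal density on a
    lattice of mesh h = 2/tau, up to the factor exp(-t^4/(4n)).  Comparing sums
    of the decreasing density with integrals turns P(U >= tau y) into a constant
    A times the normal tail at y, with an error h times the density at y
    ([tail_sum_le], [tail_sum_ge]).  In the lower bound the sum is cut off at
    Y = x + n^(1/8): far enough that the missing tail is O(1/sqrt n) of the
    tail at x, near enough that Y^4/n = O((1+x^3)/sqrt n) for x <= n^(1/6).

    The remaining errors are measured with the Mills ratio bound
    density(x) <= C (1+x) tail(x): the lattice error is O((1+x)/sqrt n), and
    passing from tau to the true standard deviation moves x by O(x/n).  All are
    O((1+x^3)/sqrt n) ([smoothed_tail_le], [smoothed_tail_ge]).  The constant A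
    is never computed: by symmetry P(U >= 0) lies between 1/2 and
    1/2 + P(K = ceil(n/2))/2, so the two bounds at x = 0 force
    A = 1 + O(1/sqrt n).  For the finitely many small n the ratio is bounded
    outright. *)

Set Implicit Arguments.
Unset Strict Implicit.
Unset Printing Implicit Defensive.

Local Open Scope classical_set_scope.
Local Open Scope ring_scope.

(** * The number of +1 spins as a birth-death chain *)

Definition pluses (n : nat) (s : n.-tuple bool) : nat := \sum_(i < n) tnth s i.

Lemma pluses_le n (s : n.-tuple bool) : (pluses s <= n)%N.
Proof.
rewrite -[leqRHS]card_ord -sum1_card; apply: leq_sum => i _.
by case: (tnth s i).
Qed.

Lemma sum_spin (R : realType) n (s : n.-tuple bool) :
  \sum_(i < n) spin R (tnth s i) = (pluses s)%:R *+ 2 - n%:R.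
Proof.
rewrite /pluses natr_sum -sumrMnl -[n in n%:R]card_ord -sum1_card natr_sum.
rewrite -sumrB; apply: eq_bigr => i _; rewrite /spin.
by case: (tnth s i) => /=; rewrite ?mul0rn ?sub0r// mulr2n addrK.
Qed.

(** Stated additively, so that no truncated subtraction appears. *)
Lemma pluses_move n (s : n.-tuple bool) (i j : 'I_n) :
  (pluses (antivoter_move s i j) + tnth s i =
   pluses s + ~~ tnth s j)%N.
Proof.
rewrite /pluses (bigD1 i)//= [in RHS](bigD1 i)//= tnth_mktuple eqxx.
rewrite (eq_bigr (fun k => tnth s k : nat)); first by lia.
by move=> k /negbTE ki; rewrite tnth_mktuple ki.
Qed.

Section generator.
Variables (R : realType) (n : nat) (p : n.-tuple bool -> R).
Hypotheses (n3 : (3 <= n)%N) (pstat : antivoter_stationary p).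

(** The sums of b_i b_j over ordered pairs of distinct vertices, for b the
    indicator of +1 or of -1 spins, are m(m-1) and (n-m)(n-m-1). *)
Lemma sum_move (h : nat -> R) (s : n.-tuple bool) (m := pluses s) :
  \sum_(i < n) \sum_(j < n | j != i) (h (pluses (antivoter_move s i j)) - h m)
  = (n%:R - m%:R) * (n%:R - m%:R - 1) * (h m.+1 - h m)
    + m%:R * (m%:R - 1) * (h m.-1 - h m).
Proof.
pose b (i : 'I_n) : R := (tnth s i)%:R.
have stepE i j : h (pluses (antivoter_move s i j)) - h m =
  (1 - b i) * (1 - b j) * (h m.+1 - h m) + b i * b j * (h m.-1 - h m).
  have := pluses_move s i j; rewrite -/m /b.
  case: (tnth s i); case: (tnth s j) => /= e.
  - by rewrite (_ : pluses _ = m.-1); [ring | lia].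
  - by rewrite (_ : pluses _ = m); [ring | lia].
  - by rewrite (_ : pluses _ = m); [ring | lia].
  - by rewrite (_ : pluses _ = m.+1); [ring | lia].
have sumb : \sum_i b i = m%:R by rewrite /m /pluses natr_sum.
have offdiag (g : 'I_n -> R) : (forall i, g i * g i = g i) ->
    \sum_(i < n) \sum_(j < n | j != i) g i * g j =
    (\sum_i g i) * (\sum_i g i - 1).
  move=> gg; rewrite mulr_suml; apply: eq_bigr => i _.
  rewrite -mulr_sumr [in RHS](bigD1 i)//= mulrBr mulrDr gg mulr1; ring.
have offb := offdiag b; have offc := offdiag (fun i => 1 - b i).
rewrite sumrB sumb sumr_const card_ord in offc.
rewrite sumb in offb.
have bb i : b i * b i = b i by rewrite /b; case: (tnth s i) => /=; ring.
rewrite -(offb bb) -offc; last by move=> i; have := bb i; nra.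
rewrite !mulr_suml -big_split/=; apply: eq_bigr => i _.
rewrite !mulr_suml -big_split/=; apply: eq_bigr => j _.
by rewrite stepE.
Qed.

(** In stationarity the expected one-step change of any function of the number
    of +1 spins vanishes.  An indicator [h] yields the law of that number, a
    power its moments. *)
Lemma generator_identity (h : nat -> R) :
  \sum_s p s * ((n%:R - (pluses s)%:R) * (n%:R - (pluses s)%:R - 1)
       * (h (pluses s).+1 - h (pluses s))
    + (pluses s)%:R * ((pluses s)%:R - 1) * (h (pluses s).-1 - h (pluses s)))
  = 0.
Proof.
have [_ _ st] := pstat.
under eq_bigr do rewrite -sum_move.
have nu : n%:R != 0 :> R by rewrite pnatr_eq0; lia.
have n1u : n.-1%:R != 0 :> R by rewrite pnatr_eq0; lia.
have E1 : \sum_t p t * h (pluses t) = \sum_s p s *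
    (n%:R^-1 * n.-1%:R^-1 * \sum_(i < n) \sum_(j < n | j != i)
     h (pluses (antivoter_move s i j))).
  under eq_bigr => t _ do rewrite -(st t) mulr_suml.
  rewrite exchange_big/=; apply: eq_bigr => s _.
  under eq_bigr do rewrite -mulrA.
  rewrite -mulr_sumr; congr (_ * _).
  rewrite /antivoter_transition.
  under [LHS]eq_bigr do rewrite mulr_suml.
  rewrite exchange_big/= mulr_sumr; apply: eq_bigr => i _.
  under [LHS]eq_bigr do rewrite -mulrA mulr_suml.
  rewrite -mulr_sumr -mulrA; congr (_ * _).
  rewrite exchange_big/= mulr_sumr; apply: eq_bigr => j _.
  rewrite (bigD1 (antivoter_move s i j))//= eqxx mulr1 big1 ?addr0//.
  by move=> t /negbTE tm; rewrite eq_sym tm mulr0 mul0r.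
have E2 : \sum_t p t * h (pluses t) = \sum_s p s *
    (n%:R^-1 * n.-1%:R^-1 * \sum_(i < n) \sum_(j < n | j != i) h (pluses s)).
  apply: eq_bigr => s _; congr (_ * _).
  under eq_bigr => i _.
    rewrite sumr_const (_ : #|_| = n.-1); last first.
      by rewrite cardC1 card_ord.
    over.
  rewrite sumr_const card_ord -[h _ *+ _]mulr_natr -[_ *+ n]mulr_natr; field.
  by rewrite nu n1u.
apply: (mulfI (mulf_neq0 (invr_neq0 nu) (invr_neq0 n1u))).
rewrite mulr0 -[RHS](subrr (\sum_t p t * h (pluses t))) {1}E1 E2 -sumrB.
rewrite mulr_sumr; apply: eq_bigr => s _.
rewrite mulrCA -mulrBr -mulrBr; congr (_ * (_ * _)).
by rewrite -sumrB; apply: eq_bigr => i _; rewrite sumrB.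
Qed.

Definition plus_law (k : nat) : R := \sum_(s | pluses s == k) p s.

Lemma sum_plus_law (g : nat -> R) :
  \sum_s p s * g (pluses s) = \sum_(k < n.+1) plus_law k * g k.
Proof.
rewrite (partition_big (fun s => inord (pluses s) : 'I_n.+1) xpredT)//=.
apply: eq_bigr => k _; rewrite /plus_law mulr_suml.
have kE (s : n.-tuple bool) : ((inord (pluses s) : 'I_n.+1) == k) = (pluses s == k).
  by rewrite -val_eqE/= inordK// ltnS pluses_le.
rewrite (eq_bigl _ _ kE).
by apply: eq_bigr => s /eqP ->.
Qed.

Lemma plus_law_ge0 k : 0 <= plus_law k.
Proof. by have [p0 _ _] := pstat; apply: sumr_ge0. Qed.

Lemma plus_law_sum1 : \sum_(k < n.+1) plus_law k = 1.
Proof.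
have [_ <- _] := pstat; have := sum_plus_law (fun=> 1).
by under eq_bigr do rewrite mulr1; under [X in _ = X]eq_bigr do rewrite mulr1.
Qed.

(** A birth-death chain crosses the edge between [k] and [k.+1] equally often in
    both directions: take for [h] the indicator of the states above [k]. *)
Lemma plus_law_balance k : (k < n)%N ->
  plus_law k * ((n%:R - k%:R) * (n%:R - k%:R - 1)) =
  plus_law k.+1 * (k.+1%:R * k%:R).
Proof.
move=> kn; have := generator_identity (fun l => (k < l)%:R).
pose g (l : nat) : R := (n%:R - l%:R) * (n%:R - l%:R - 1)
       * ((k < l.+1)%:R - (k < l)%:R)
    + l%:R * (l%:R - 1) * ((k < l.-1)%:R - (k < l)%:R).
have k1 : (k < n.+1)%N by lia.
rewrite -/(g _) (sum_plus_law g) (bigD1 (Ordinal k1))//=.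
rewrite (bigD1 (Ordinal (kn : (k.+1 < n.+1)%N)))//=; last first.
  by rewrite -val_eqE/=; lia.
rewrite big1 ?addr0; last first.
  move=> i /andP[]; rewrite -!val_eqE/= => ik ik1; rewrite /g.
  rewrite (_ : (k < i.+1)%N = (k < i)%N); last by apply/idP/idP; lia.
  rewrite (_ : (k < i.-1)%N = (k < i)%N); last by apply/idP/idP; lia.
  ring.
have -> : g k = (n%:R - k%:R) * (n%:R - k%:R - 1).
  rewrite /g ltnn ltnSn (_ : (k < k.-1)%N = false); last by apply/negP; lia.
  rewrite /=; ring.
have -> : g k.+1 = - (k.+1%:R * k%:R).
  rewrite /g ltnn ltnSn (_ : (k < k.+2)%N = true); last by lia.
  by rewrite /= -[k.+1%:R]natr1; ring.
by rewrite mulrN => /eqP; rewrite subr_eq0 => /eqP.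
Qed.

End generator.

(** * The stationary law: symmetry and second moment *)

Section stationary_law.
Variables (R : realType) (n : nat) (p : n.-tuple bool -> R).
Hypotheses (n3 : (3 <= n)%N) (pstat : antivoter_stationary p).

(** In sums weighted by [m%:R], the truncated predecessor may be replaced by
    [m%:R - 1]: the two differ only at [m = 0], where the weight vanishes. *)
Lemma natr_pred_drop (m : nat) (x : R) : m%:R * (m.-1%:R - m%:R + 1) * x = 0.
Proof. by case: m => [|m]; rewrite ?mul0r// -[m.+1%:R]natr1/=; ring. Qed.

(** The drift of the number m of +1 spins is proportional to
    (n-m)(n-m-1) - m(m-1) = (n-1)(n-2m). *)
Lemma mean_spin_sum : \sum_s p s * ((pluses s)%:R *+ 2 - n%:R) = 0.
Proof.
have := generator_identity n3 pstat (fun k => k%:R).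
rewrite (eq_bigr (fun s => (1 - n%:R) * (p s * ((pluses s)%:R *+ 2 - n%:R)))); last first.
  move=> s _; have := natr_pred_drop (pluses s) (p s * ((pluses s)%:R - 1)).
  set a := _.-1%:R => e; rewrite -[(pluses s).+1%:R]natr1.
  by apply/eqP; rewrite -subr_eq0 -e; apply/eqP; ring.
rewrite -mulr_sumr => /eqP; rewrite mulf_eq0 => /orP[|/eqP//].
by rewrite subr_eq0 eq_sym pnatr_eq1 => /eqP; lia.
Qed.

(** The generator applied to m^2 is (1-n) n u + (n (n-2) - (2n-3) u^2)/2 with
    u = 2m - n, and u has mean zero. *)
Lemma second_moment_spin_sum :
  \sum_s p s * ((pluses s)%:R *+ 2 - n%:R) ^+ 2 =
  n%:R * (n%:R - 2) / (n%:R *+ 2 - 3).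
Proof.
have d0 : n%:R *+ 2 - 3 != 0 :> R.
  have : 3 <= n%:R :> R by rewrite ler_nat.
  by move=> ?; apply: lt0r_neq0; rewrite -mulr_natr; lra.
apply: (mulIf d0); rewrite mulfVK// mulr_suml.
have [_ p1 _] := pstat.
have := generator_identity n3 pstat (fun k => k%:R ^+ 2).
rewrite (eq_bigr (fun s => (1 - n%:R) * n%:R * (p s * ((pluses s)%:R *+ 2 - n%:R))
   + 2^-1 * (n%:R * (n%:R - 2) * p s
     - p s * ((pluses s)%:R *+ 2 - n%:R) ^+ 2 * (n%:R *+ 2 - 3)))); last first.
  move=> s _; have := natr_pred_drop (pluses s)
    (p s * ((pluses s)%:R - 1) * ((pluses s).-1%:R + (pluses s)%:R)).
  have := natr_pred_drop (pluses s) (p s * ((pluses s)%:R - 1)).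
  set a := _.-1%:R => e e'; rewrite -[(pluses s).+1%:R]natr1.
  by lra.
rewrite big_split/= -!mulr_sumr mean_spin_sum mulr0 add0r sumrB -mulr_sumr p1 mulr1.
by move=> /eqP; rewrite mulf_eq0 invr_eq0 pnatr_eq0/= subr_eq0 => /eqP ->.
Qed.

(** Detailed balance determines the law from its value at 1.  The factor
    k (n-k) takes care of the two transient monochromatic states. *)
Lemma plus_law_closed_form k : (k <= n)%N ->
  plus_law p k = plus_law p 1 / (n%:R ^+ 2 * (n%:R - 1))
    * ('C(n, k)%:R ^+ 2 * (k%:R * (n%:R - k%:R))).
Proof.
have n1u : n%:R - 1 != 0 :> R by rewrite subr_eq0 pnatr_eq1; lia.
have n0u : n%:R != 0 :> R by rewrite pnatr_eq0; lia.
have bal := plus_law_balance n3 pstat.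
elim: k => [_|k IH kn].
  have := bal 0%N ltac:(lia).
  rewrite mulr0 mulr0 mul0r mulr0 mulr0 subr0 => /eqP.
  by rewrite mulf_eq0 mulf_eq0 (negbTE n0u) (negbTE n1u) !orbF => /eqP.
have [k0|k0] := posnP k.
  by rewrite k0 bin1; field; rewrite n0u n1u.
have ku : k%:R != 0 :> R by rewrite pnatr_eq0; lia.
have k1u : k.+1%:R != 0 :> R by rewrite pnatr_eq0.
apply: (mulIf (mulf_neq0 k1u ku)); rewrite -(bal k kn) (IH (ltnW kn)).
have binE : k.+1%:R * 'C(n, k.+1)%:R = (n%:R - k%:R) * 'C(n, k)%:R :> R.
  by rewrite -natrB ?(ltnW kn)// -!natrM mul_bin_left.
set g := plus_law p 1 / _.
have -> : n%:R - k.+1%:R = n%:R - k%:R - 1 :> R by rewrite -natr1; ring.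
transitivity (g * ((n%:R - k%:R) * 'C(n, k)%:R) ^+ 2 * (n%:R - k%:R - 1) * k%:R).
  ring.
by rewrite -binE; ring.
Qed.

Lemma plus_law_sym k : (k <= n)%N -> plus_law p (n - k) = plus_law p k.
Proof.
move=> kn; rewrite (plus_law_closed_form (leq_subr k n)).
rewrite [RHS](plus_law_closed_form kn) bin_sub// natrB//; ring.
Qed.

End stationary_law.

(** * Expectations of functions of a random configuration *)

Section finite_random_variable.
Variables (R : realType) (n : nat) (p : n.-tuple bool -> R).
Variables (d : measure_display) (T : measurableType d) (P : probability T R).
Variable X : {RV P >-> n.-tuple bool}.
Hypothesis lawX : forall s, distribution P X [set s] = (p s)%:E.

(** Singletons are finite intersections of cylinders, and every set of
    configurations is a finite union of singletons. *)
Lemma measurable_tuple_bool (A : set (n.-tuple bool)) : measurable A.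
Proof.
have -> : A = \bigcup_(s in A) [set s].
  by apply/seteqP; split=> [s As|s [r Ar ->]]//; exists s.
apply: fin_bigcup_measurable => // s _.
have -> : [set s] = \bigcap_(i in [set: 'I_n]) (@tnth n bool ^~ i @^-1` [set tnth s i]).
  apply/seteqP; split=> [_ -> //|r H]; apply: eq_from_tnth => i.
  exact: (H i I).
apply: fin_bigcap_measurable => // i _.
by have := @measurable_tnth _ bool n i measurableT [set tnth s i] I; rewrite setTI.
Qed.

Let atom (s : n.-tuple bool) : set T := X @^-1` [set s].

Let measurable_atom s : measurable (atom s).
Proof.
rewrite /atom -[X in measurable X]setTI; apply: measurable_funPT => //.
exact: measurable_tuple_bool.
Qed.

Lemma expectation_finite (g : n.-tuple bool -> R) :
  'E_P[fun w => g (X w)]%E = (\sum_s p s * g s)%:E.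
Proof.
rewrite unlock.
transitivity (\int[P]_w \sum_s ((g s)%:E * (\1_(atom s) w)%:E))%E.
  apply: eq_integral => w _; rewrite (bigD1 (X w))//= big1 ?adde0.
    by rewrite indicE mem_set// mule1.
  move=> s sX; rewrite indicE memNset ?mule0//= => H.
  by rewrite H eqxx in sX.
rewrite integral_sum//; last first.
  move=> s; apply: integrableZl => //; exact: integrable_indic.
rewrite -sumEFin; apply: eq_bigr => s _.
rewrite integralZl//; last exact: integrable_indic.
rewrite integral_indic// setIT mulrC EFinM -lawX; congr (_ * _)%E.
Qed.

Lemma probability_finite (Q : pred (n.-tuple bool)) :
  fine (P [set w | Q (X w)]) = \sum_(s | Q s) p s.
Proof.
have mQ : measurable [set w | Q (X w)].
  have -> : [set w | Q (X w)] = X @^-1` [set s | Q s] by [].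
  rewrite -[X in measurable X]setTI; apply: measurable_funPT => //.
  exact: measurable_tuple_bool.
rewrite -(expectation_indic P mQ).
have -> : \1_[set w | Q (X w)] = (fun w => (fun s => (Q s)%:R) (X w)) :> (T -> R).
  apply/funext => w; rewrite indicE; congr (nat_of_bool _)%:R.
  by apply/idP/idP => [/set_mem//|H]; rewrite mem_set.
rewrite (expectation_finite (fun s => (Q s)%:R))/= [RHS]big_mkcond; apply: eq_bigr => s _.
by case: (Q s); rewrite ?mulr1 ?mulr0.
Qed.

End finite_random_variable.

(** * Ratios of consecutive weights *)

Section log_ratio.
Variable R : realType.
Implicit Types a b c : R.

Let is_derive_logit c b : 0 <= b -> b < 1 ->
  is_derive b (1 : R) (fun a : R => ln (1 + a) - ln (1 - a) - (2 * a + c * a ^+ 3))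
    (2 / (1 - b ^+ 2) - (2 + 3 * c * b ^+ 2)).
Proof.
move=> b0 b1.
have d1 : is_derive b (1 : R) (fun a : R => ln (1 + a)) (1 + b)^-1.
  have p : 0 < 1 + b by lra.
  have ? := is_derive1_ln p.
  have -> : (fun a : R => ln (1 + a)) = (@ln R) \o (fun a => 1 + a) by [].
  by apply: is_derive_eq; rewrite add0r /GRing.scale/= !mulr1.
have d2 : is_derive b (1 : R) (fun a : R => ln (1 - a)) (- (1 - b)^-1).
  have p : 0 < 1 - b by lra.
  have ? := is_derive1_ln p.
  have -> : (fun a : R => ln (1 - a)) = (@ln R) \o (fun a => 1 - a) by [].
  by apply: is_derive_eq; rewrite ?add0r ?sub0r /GRing.scale/= ?scaleN1r ?mulrN !mulr1.
apply: is_derive_eq; rewrite /GRing.scale/=.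
have u1 : 1 - b ^+ 2 != 0 by rewrite gt_eqF//; nra.
have u2 : 1 + b != 0 by rewrite gt_eqF//; lra.
have u3 : 1 - b != 0 by rewrite gt_eqF//; lra.
by field; rewrite u1 u2 u3.
Qed.

(** The function ln((1+a)/(1-a)) - 2a - c a^3 vanishes at 0, so its sign follows
    from that of its derivative.  The factor [s] covers both directions:
    [s = 1], [c = 0] for the lower bound and [s = -1], [c = 2] for the upper
    bound. *)
Lemma logit_sign s c b : 0 <= b -> b < 1 ->
  (forall a, 0 <= a -> a <= b ->
     0 <= s * (2 / (1 - a ^+ 2) - (2 + 3 * c * a ^+ 2))) ->
  0 <= s * (ln (1 + b) - ln (1 - b) - (2 * b + c * b ^+ 3)).
Proof.
move=> b0 b1 H.
pose g := fun a : R => ln (1 + a) - ln (1 - a) - (2 * a + c * a ^+ 3).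
pose f := fun a : R => s * g a.
have -> : 0 = f 0 by rewrite /f /g addr0 subr0 ln1; ring.
have d a : 0 <= a -> a <= b ->
    is_derive a (1 : R) f (s * (2 / (1 - a ^+ 2) - (2 + 3 * c * a ^+ 2))).
  move=> a0 ab; have ? := @is_derive_logit c a a0 (le_lt_trans ab b1).
  exact: is_deriveZ.
apply: (@ger0_derive1_ndecr _ f 0 b) => //.
- move=> x; rewrite in_itv/= => /andP[/ltW x0 /ltW xb].
  by have ? := d x x0 xb; exact: ex_derive.
- move=> x; rewrite in_itv/= => /andP[/ltW x0 /ltW xb].
  by have ? := d x x0 xb; rewrite derive1E derive_val; exact: H.
- apply: derivable_within_continuous => x; rewrite in_itv/= => /andP[x0 xb].
  by have ? := d x x0 xb; exact: ex_derive.
Qed.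

End log_ratio.

Section ratio.
Variable R : realType.
Implicit Types a b c : R.

Lemma ratio_le_expR a : 0 <= a -> a <= 1 -> 1 - a <= (1 + a) * expR (- (2 * a)).
Proof.
move=> a0; rewrite le_eqVlt => /predU1P[->|a1].
  by rewrite subrr mulr_ge0 ?expR_ge0.
have H : 0 <= 1 * (ln (1 + a) - ln (1 - a) - (2 * a + 0 * a ^+ 3)).
  apply: logit_sign => // b b0 ba.
  have p : 0 < 1 - b ^+ 2 by nra.
  have : 2 <= 2 / (1 - b ^+ 2) by rewrite ler_pdivlMr//; nra.
  lra.
have p : 0 < 1 + a by lra.
have q : 0 < 1 - a by lra.
rewrite -[X in X <= _]lnK ?posrE// -[X in X * _]lnK ?posrE//.
by rewrite -expRD ler_expR; lra.
Qed.

(** The constraint [3 * a <= 2] keeps 2 / (1 - a^2) below 2 + 6 a^2, which fails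
    when a^2 exceeds 2/3. *)
Lemma expR_le_ratio a : 0 <= a -> 3 * a <= 2 ->
  (1 + a) * expR (- (2 * a + 2 * a ^+ 3)) <= 1 - a.
Proof.
move=> a0 a1.
have a1' : a < 1 by lra.
have H : 0 <= (-1) * (ln (1 + a) - ln (1 - a) - (2 * a + 2 * a ^+ 3)).
  apply: logit_sign => // b b0 ba.
  have b2 : b ^+ 2 <= 4 / 9 by nra.
  have p : 0 < 1 - b ^+ 2 by lra.
  have : 2 / (1 - b ^+ 2) <= 2 + 3 * 2 * b ^+ 2.
    by rewrite ler_pdivrMr//; have := sqr_ge0 b; nra.
  lra.
have p : 0 < 1 + a by lra.
have q : 0 < 1 - a by lra.
rewrite -[X in _ <= X]lnK ?posrE// -[X in X * _]lnK ?posrE//.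
by rewrite -expRD ler_expR; lra.
Qed.
End ratio.

(** * Gaussian bounds on the weights *)

Section weights.
Variables (R : realType) (n : nat) (f : nat -> R).
Hypotheses (f0 : forall k, 0 <= f k)
  (bal : forall k, (k < n)%N ->
    f k * ((n%:R - k%:R) * (n%:R - k%:R - 1)) = f k.+1 * (k.+1%:R * k%:R)).

Let u (k : nat) : R := k%:R *+ 2 - n%:R.

Let uS k : u k.+1 = u k + 2.
Proof. by rewrite /u -natr1 mulrnDl; ring. Qed.

Let u_ge0 k : (n <= k.*2)%N -> 0 <= u k.
Proof.
by move=> nk; rewrite /u subr_ge0 -mulrnA ler_nat muln2.
Qed.

(** Detailed balance as a ratio: n-k, n-k-1, k and k+1 are n/2 times 1-b, 1-a,
    1+b and 1+a, where b and a are u/n before and after the step. *)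
Let balance_scaled k : (0 < n)%N -> (k < n)%N ->
  f k * ((1 - u k.+1 / n%:R) * (1 - u k / n%:R)) =
  f k.+1 * ((1 + u k.+1 / n%:R) * (1 + u k / n%:R)).
Proof.
move=> n0 kn; have nu : n%:R != 0 :> R by rewrite pnatr_eq0; lia.
have c0 : n%:R ^+ 2 / 4 != 0 :> R by rewrite mulf_neq0// expf_neq0.
apply: (mulIf c0); have := bal kn; rewrite /u -!natr1 => e.
transitivity (f k * ((n%:R - k%:R) * (n%:R - k%:R - 1))); first by field.
by rewrite e; field.
Qed.

(** Each step contributes at most exp(-2a - 2b), and 2a + 2b is exactly the
    increment of u^2/n, so the bounds telescope. *)
Lemma weight_le k j : (0 < k)%N -> (n <= k.*2)%N -> (k + j <= n)%N ->
  f (k + j) <= f k * expR (- (u (k + j) ^+ 2 - u k ^+ 2) / n%:R).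
Proof.
move=> k0 nk; elim: j => [|j IH] kj.
  by rewrite addn0 subrr oppr0 mul0r expR0 mulr1.
have n0 : (0 < n)%N by lia.
have nu : n%:R != 0 :> R by rewrite pnatr_eq0; lia.
have np : 0 < n%:R :> R by rewrite ltr0n.
set m := (k + j)%N in IH *.
have mn : (m < n)%N by rewrite /m; lia.
have um : 0 <= u m by apply: u_ge0; rewrite /m; lia.
have um1 : u m.+1 <= n%:R.
  rewrite /u lerBlDr -mulrnA -natrD ler_nat; lia.
have := balance_scaled n0 mn; rewrite addnS -/m.
have us := uS m.
set a := u m.+1 / n%:R; set b := u m / n%:R => e.
have b0 : 0 <= b by rewrite divr_ge0// ltW.
have a0 : 0 <= a by rewrite divr_ge0// ?ltW//; lra.
have a1 : a <= 1 by rewrite ler_pdivrMr// mul1r.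
have b1 : b <= 1 by rewrite ler_pdivrMr// mul1r; lra.
have p : 0 < (1 + a) * (1 + b) by rewrite mulr_gt0//; lra.
rewrite -(ler_pM2r p) -e.
apply: (@le_trans _ _ (f m *
  (((1 + a) * expR (- (2 * a))) * ((1 + b) * expR (- (2 * b)))))).
  apply: ler_wpM2l => //; apply: ler_pM; rewrite ?subr_ge0//; exact: ratio_le_expR.
apply: (@le_trans _ _ (f k * expR (- (u m ^+ 2 - u k ^+ 2) / n%:R) *
  (((1 + a) * expR (- (2 * a))) * ((1 + b) * expR (- (2 * b)))))).
  apply: ler_wpM2r; last by apply: IH; lia.
  by rewrite !mulr_ge0 ?expR_ge0//; lra.
have -> : - (u m.+1 ^+ 2 - u k ^+ 2) / n%:R =
    - (u m ^+ 2 - u k ^+ 2) / n%:R + - (2 * a) + - (2 * b).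
  by rewrite /a /b us; field.
by rewrite !expRD le_eqVlt; apply/orP; left; apply/eqP; ring.
Qed.

(** The cubic corrections 2a^3 + 2b^3 of the steps are absorbed by the increments
    of u^4/n^3, since (u+2)^4 - u^4 >= 2 (u+2)^3 + 2 u^3. *)
Lemma weight_ge k j : (0 < k)%N -> (n <= k.*2)%N -> (k + j <= n)%N ->
  3 * u (k + j) <= 2 * n%:R ->
  f k * expR (- (u (k + j) ^+ 2 / n%:R + u (k + j) ^+ 4 / n%:R ^+ 3))
  <= f (k + j).
Proof.
move=> k0 nk; elim: j => [|j IH] kj ukj.
  rewrite addn0 ler_piMr// -[leRHS]expR0 ler_expR oppr_le0.
  by rewrite addr_ge0// divr_ge0// ?exprn_ge0// ?sqr_ge0// u_ge0.
have n0 : (0 < n)%N by lia.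
have nu : n%:R != 0 :> R by rewrite pnatr_eq0; lia.
have np : 0 < n%:R :> R by rewrite ltr0n.
rewrite addnS in ukj *; set m := (k + j)%N in IH ukj *.
have mn : (m < n)%N by rewrite /m; lia.
have um : 0 <= u m by apply: u_ge0; rewrite /m; lia.
have := balance_scaled n0 mn.
have us := uS m.
set a := u m.+1 / n%:R; set b := u m / n%:R => e.
have b0 : 0 <= b by rewrite divr_ge0// ltW.
have ba : b <= a by rewrite ler_pM2r ?invr_gt0//; lra.
have a1 : 3 * a <= 2 by rewrite mulrA ler_pdivrMr.
have p : 0 < (1 + a) * (1 + b) by rewrite mulr_gt0//; lra.
rewrite -(ler_pM2r p) -e.
set ea := expR (- (2 * a + 2 * a ^+ 3)).
set eb := expR (- (2 * b + 2 * b ^+ 3)).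
apply: (@le_trans _ _ (f m * (((1 + a) * ea) * ((1 + b) * eb)))); last first.
  apply: ler_wpM2l => //; apply: ler_pM; rewrite ?mulr_ge0 ?expR_ge0//; try lra.
    by apply: expR_le_ratio => //; lra.
  by apply: expR_le_ratio => //; lra.
apply: (@le_trans _ _ (f k * expR (- (u m ^+ 2 / n%:R + u m ^+ 4 / n%:R ^+ 3)) *
  (((1 + a) * ea) * ((1 + b) * eb)))); last first.
  apply: ler_wpM2r; last by apply: IH; [lia | lra].
  by rewrite !mulr_ge0 ?expR_ge0//; lra.
rewrite [leRHS](_ : _ = f k * (expR (- (u m ^+ 2 / n%:R + u m ^+ 4 / n%:R ^+ 3))
   * (ea * eb)) * ((1 + a) * (1 + b))); last by ring.
rewrite ler_pM2r// ler_wpM2l// /ea /eb -!expRD ler_expR.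
rewrite [leLHS](_ : _ = - (u m ^+ 2 / n%:R + u m ^+ 4 / n%:R ^+ 3)
   - (2 * a + 2 * b) - (u m.+1 ^+ 4 - u m ^+ 4) / n%:R ^+ 3); last first.
  by rewrite /a /b us; field.
suff : 2 * a ^+ 3 + 2 * b ^+ 3 <= (u m.+1 ^+ 4 - u m ^+ 4) / n%:R ^+ 3 by lra.
rewrite /a /b !expr_div_n !mulrA -mulrDl ler_pM2r ?invr_gt0 ?exprn_gt0// us.
have := mulr_ge0 um um; have := mulr_ge0 (mulr_ge0 um um) um; nra.
Qed.

End weights.

(** * The standard normal tail *)

Section gaussian_tail.
Variable R : realType.
Implicit Types a b x y L : R.
Local Notation mu := (@lebesgue_measure R).

Definition std_pdf x : R := normal_peak 1 * expR (- x ^+ 2 / 2).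

Definition std_tail x : R := 1 - std_normal_cdf x.

Lemma normal_pdf_std : normal_pdf 0 1 = std_pdf.
Proof.
apply/funext => x; rewrite normal_pdfE ?oner_eq0// /std_pdf /normal_fun.
by rewrite subr0 expr1n.
Qed.

Lemma std_pdf_gt0 x : 0 < std_pdf x.
Proof. by rewrite mulr_gt0 ?expR_gt0// normal_peak_gt0 ?oner_eq0. Qed.

Lemma std_pdf_ge0 x : 0 <= std_pdf x.
Proof. exact/ltW/std_pdf_gt0. Qed.

Lemma continuous_std_pdf : continuous std_pdf.
Proof. by rewrite -normal_pdf_std; apply: continuous_normal_pdf; rewrite oner_eq0. Qed.

Lemma measurable_std_pdf (D : set R) : measurable D ->
  measurable_fun D (fun x : R => (std_pdf x)%:E).
Proof.
move=> mD; apply/measurable_EFinP; apply: measurable_funTS.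
by rewrite -normal_pdf_std; exact: measurable_normal_pdf.
Qed.

Lemma std_pdf_le x y : 0 <= x -> x <= y -> std_pdf y <= std_pdf x.
Proof.
move=> x0 xy; rewrite ler_pM2l ?normal_peak_gt0 ?oner_eq0// ler_expR.
by rewrite ler_pM2r// lerN2 ler_sqr ?nnegrE// (le_trans x0).
Qed.

Lemma normal_probE (A : set R) :
  normal_prob 0 1 A = (\int[mu]_(x in A) (std_pdf x)%:E)%E.
Proof. by rewrite /normal_prob normal_pdf_std. Qed.

Lemma std_tail_int x :
  (std_tail x)%:E = (\int[mu]_(t in `]x, +oo[) (std_pdf t)%:E)%E.
Proof.
pose P : probability _ R := normal_prob 0 1.
rewrite -normal_probE -/(P _) -setCitvl probability_setC//.
rewrite /std_tail /std_normal_cdf EFinB fineK// -/(P _).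
exact: fin_num_measure.
Qed.

Lemma std_tail_sub a b : a <= b ->
  (std_tail a - std_tail b)%:E = (\int[mu]_(t in `]a, b]) (std_pdf t)%:E)%E.
Proof.
move=> ab; pose P : probability _ R := normal_prob 0 1.
have Pfin (A : set R) : measurable A -> P A \is a fin_num.
  by move=> mA; exact: fin_num_measure.
rewrite -normal_probE -/(P _) -(fineK (Pfin _ _))//; congr EFin.
rewrite /std_tail /std_normal_cdf -/(P _) -/(P _).
have M : P `]-oo, b]%classic = (P `]-oo, a]%classic + P `]a, b]%classic)%E.
  rewrite -measureU//; last first.
    apply/disj_set2P/disj_setPS => t /=; rewrite !in_itv/= => -[ta /andP[]].
    by rewrite ltNge ta.
  by rewrite -itv_bndbnd_setU// bnd_simp.
by rewrite M (fineD (Pfin _ _) (Pfin _ _))//; ring.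
Qed.

Lemma std_tail_lip a b : 0 <= a -> a <= b ->
  std_tail a - std_tail b <= (b - a) * std_pdf a.
Proof.
move=> a0 ab; rewrite -lee_fin std_tail_sub//.
apply: (@le_trans _ _ (\int[mu]_(t in `]a, b]) (cst (std_pdf a)%:E t))%E).
  apply: ge0_le_integral => //.
  - by move=> t _; rewrite lee_fin std_pdf_ge0.
  - exact: measurable_std_pdf.
  - move=> t /=; rewrite in_itv/= => /andP[/ltW at_ _].
    by rewrite lee_fin std_pdf_le.
rewrite integral_cst//= lebesgue_measure_itv/= lte_fin.
case: ifPn => [_|]; first by rewrite -EFinB -EFinM mulrC.
by rewrite mule0 lee_fin mulr_ge0 ?subr_ge0// std_pdf_ge0.
Qed.

Lemma std_tail_sub_ge a b : 0 <= a -> a <= b ->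
  (b - a) * std_pdf b <= std_tail a - std_tail b.
Proof.
move=> a0 ab; rewrite -lee_fin std_tail_sub//.
apply: (@le_trans _ _ (\int[mu]_(t in `]a, b]) (cst (std_pdf b)%:E t))%E); last first.
  apply: ge0_le_integral => //.
  - by move=> t _; rewrite lee_fin std_pdf_ge0.
  - exact: measurable_std_pdf.
  - move=> t /=; rewrite in_itv/= => /andP[/ltW at_ tb].
    by rewrite lee_fin std_pdf_le// (le_trans a0).
rewrite integral_cst//= lebesgue_measure_itv/= lte_fin.
case: ifPn => [_|]; first by rewrite -EFinB -EFinM mulrC.
rewrite -leNgt => ba; rewrite mule0 lee_fin.
by rewrite (le_anti (introT andP (conj ab ba))) subrr mul0r.
Qed.

Lemma std_tail_ge0 x : 0 <= std_tail x.
Proof.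
rewrite -lee_fin std_tail_int; apply: integral_ge0 => t _.
by rewrite lee_fin std_pdf_ge0.
Qed.

Lemma std_tail_gt0 x : 0 <= x -> 0 < std_tail x.
Proof.
move=> x0; have x1 : x <= x + 1 by rewrite lerDl.
have := std_tail_sub_ge x0 x1; have := std_tail_ge0 (x + 1).
have := std_pdf_gt0 (x + 1); rewrite addrAC subrr add0r mul1r; lra.
Qed.

Lemma std_tail_le a b : a <= b -> std_tail b <= std_tail a.
Proof.
move=> ab; rewrite -subr_ge0 -lee_fin std_tail_sub//.
by apply: integral_ge0 => t _; rewrite lee_fin std_pdf_ge0.
Qed.

(** The density is even and has total mass 1. *)
Lemma std_tail0 : std_tail 0 = 2^-1.
Proof.
have : (\int[mu]_x (std_pdf x)%:E = 2%:E * (std_tail 0)%:E)%E.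
  rewrite ge0_symfun_integralT; first last.
  - by move=> x; rewrite /std_pdf/= sqrrN.
  - exact: continuous_std_pdf.
  - by move=> x; rewrite std_pdf_ge0.
  rewrite std_tail_int integral_itv_obnd_cbnd; last exact: measurable_std_pdf.
  by rewrite set_itvcy.
rewrite -normal_pdf_std integral_normal_pdf -EFinM => -[] e.
by apply: (@mulfI _ 2) => //; rewrite -e divff.
Qed.

(** After the change of variables t -> t + L, the factor exp(-L^2/2) comes out of
    (t+L)^2 >= t^2 + L^2, valid because [t] and [L] are nonnegative. *)
Lemma std_tail_shift x L : 0 <= x -> 0 <= L ->
  std_tail (x + L) <= expR (- L ^+ 2 / 2) * std_tail x.
Proof.
move=> x0 L0; rewrite -lee_fin EFinM !std_tail_int.
pose F := fun t : R => t + L.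
have dF (t : R) : is_derive t (1 : R) F (1 : R).
  by apply: is_derive_eq; rewrite addr0.
have F'E : F^`()%classic = cst 1.
  by apply/funext => t; rewrite derive1E derive_val.
have cF : continuous F by move=> t; apply: cvgD; [exact: cvg_id|exact: cvg_cst].
have mtail : measurable_fun `]x, +oo[ (EFin \o std_pdf).
  exact: measurable_std_pdf.
rewrite integral_itv_obnd_cbnd; last exact: measurable_std_pdf.
rewrite integral_itv_obnd_cbnd//.
rewrite (@increasing_ge0_integration_by_substitutiony _ F).
- rewrite -ge0_integralZl//.
  + apply: ge0_le_integral => //.
    * by move=> t _; rewrite lee_fin F'E/= mulr1 std_pdf_ge0.
    * apply/measurable_EFinP; rewrite F'E; apply: measurable_funM => //.
      apply: measurable_funTS; apply: continuous_measurable_fun => t.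
      by apply: continuous_comp; [exact: cF|exact: continuous_std_pdf].
    * apply: emeasurable_funM => //; exact: measurable_std_pdf.
    * move=> t /=; rewrite in_itv/= andbT => xt; rewrite F'E/= mulr1 -EFinM lee_fin.
      rewrite /std_pdf mulrCA ler_pM2l ?normal_peak_gt0 ?oner_eq0// -expRD ler_expR.
      have := mulr_ge0 L0 (le_trans x0 xt); rewrite /F; nra.
  + exact: measurable_std_pdf.
  + by move=> t _; rewrite lee_fin std_pdf_ge0.
- by move=> s t _ _ st; rewrite ltrD2r.
- by rewrite F'E => t _; exact: cvg_cst.
- by rewrite F'E; exact: is_cvg_cst.
- by rewrite F'E; exact: is_cvg_cst.
- split => [t _|]; first exact: ex_derive.
  by apply: cvg_at_right_filter; exact: cF.
- exact: cvg_addrr.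
- by apply: continuous_subspaceT; exact: continuous_std_pdf.
- by move=> t _; rewrite std_pdf_ge0.
Qed.

(** A weak form of the Mills ratio bound: on an interval of length 1/(1+x) to the
    right of [x] the density drops by at most a constant factor, so the tail is at
    least a constant times density(x)/(1+x). *)
Lemma std_pdf_le_tail x : 0 <= x ->
  std_pdf x <= expR 2 * (1 + x) * std_tail x.
Proof.
move=> x0; set h := (1 + x)^-1.
have x1 : 0 < 1 + x by lra.
have h0 : 0 < h by rewrite invr_gt0.
have hx : h * (1 + x) = 1 by rewrite mulVf ?gt_eqF.
have h1 : h <= 1 by have := mulr_ge0 (ltW h0) x0; lra.
have xh : x <= x + h by lra.
have := std_tail_sub_ge x0 xh; rewrite addrAC subrr add0r => T1.
have T2 : h * std_pdf (x + h) <= std_tail x.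
  by have := std_tail_ge0 (x + h); lra.
have P : std_pdf x <= expR 2 * std_pdf (x + h).
  rewrite /std_pdf mulrCA ler_pM2l ?normal_peak_gt0 ?oner_eq0// -expRD ler_expR.
  have hx1 : h * x <= 1 by lra.
  have : h * h <= 1 by nra.
  by lra.
apply: (le_trans P); rewrite -mulrA ler_pM2l ?expR_gt0//.
by have := ler_wpM2l (ltW x1) T2; rewrite mulrA [_ * h]mulrC hx mul1r.
Qed.

End gaussian_tail.

(** * Lattice sums of the density against its tail integral *)

Section riemann.
Variable R : realType.
Implicit Types t h : R.

Lemma riemann_sum_le t h m : 0 <= t -> 0 <= h ->
  \sum_(j < m) h * std_pdf (t + j%:R * h) <= std_tail t + h * std_pdf t.
Proof.
move=> t0 h0; case: m => [|m].
  by rewrite big_ord0 addr_ge0 ?std_tail_ge0// mulr_ge0// std_pdf_ge0.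
rewrite big_ord_recl/= mul0r addr0 addrC lerD2r.
apply: (@le_trans _ _ (\sum_(0 <= j < m)
    (std_tail (t + j%:R * h) - std_tail (t + j.+1%:R * h)))).
  rewrite big_mkord; apply: ler_sum => j _; rewrite /bump/= add1n.
  have tj : 0 <= t + j%:R * h by rewrite addr_ge0 ?mulr_ge0.
  have tj1 : t + j%:R * h <= t + j.+1%:R * h.
    by rewrite lerD2l ler_wpM2r// ler_nat.
  apply: le_trans (std_tail_sub_ge tj tj1).
  by rewrite -[j.+1%:R]natr1 (_ : _ - _ = h)//; ring.
under eq_bigr do rewrite -[_ - _]opprB.
rewrite sumrN telescope_sumr//= opprB mul0r addr0 lerBlDr lerDl.
exact: std_tail_ge0.
Qed.

Lemma riemann_sum_ge t h m : 0 <= t -> 0 <= h ->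
  std_tail t - std_tail (t + m%:R * h) <= \sum_(j < m) h * std_pdf (t + j%:R * h).
Proof.
move=> t0 h0; have -> : std_tail t - std_tail (t + m%:R * h) = \sum_(0 <= j < m)
    (std_tail (t + j%:R * h) - std_tail (t + j.+1%:R * h)).
  under eq_bigr do rewrite -[_ - _]opprB.
  by rewrite sumrN telescope_sumr//= opprB mul0r addr0.
rewrite big_mkord; apply: ler_sum => j _.
have tj : 0 <= t + j%:R * h by rewrite addr_ge0 ?mulr_ge0.
have tj1 : t + j%:R * h <= t + j.+1%:R * h.
  by rewrite lerD2l ler_wpM2r// ler_nat.
apply: (le_trans (std_tail_lip tj tj1)).
by rewrite -[j.+1%:R]natr1 (_ : _ - _ = h)//; ring.
Qed.

End riemann.

(** In this section [t k] is the lattice point attached to [k], [mid] the first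
    index with [0 <= t k], and [A] the constant by which a lattice sum of the
    density must be multiplied to match the weights at the middle. *)
Section tail_sums.
Variables (R : realType) (n : nat) (f : nat -> R).
Hypotheses (n3 : (3 <= n)%N) (f0 : forall k, 0 <= f k)
  (bal : forall k, (k < n)%N ->
    f k * ((n%:R - k%:R) * (n%:R - k%:R - 1)) = f k.+1 * (k.+1%:R * k%:R)).

Let tau : R := Num.sqrt (n%:R / 2).
Let h : R := 2 / tau.
Let u (k : nat) : R := k%:R *+ 2 - n%:R.
Let t (k : nat) : R := u k / tau.
Let mid := uphalf n.
Let A := f mid / (h * normal_peak 1).

Let np : 0 < n%:R :> R. Proof. by rewrite ltr0n; lia. Qed.
Let tau0 : 0 < tau. Proof. by rewrite sqrtr_gt0 divr_gt0. Qed.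
Let tau2 : tau ^+ 2 = n%:R / 2.
Proof. by rewrite sqr_sqrtr// ltW// divr_gt0. Qed.
Let h0 : 0 < h. Proof. by rewrite divr_gt0. Qed.
Let c0 : 0 < normal_peak 1 :> R.
Proof. by rewrite normal_peak_gt0 ?oner_eq0. Qed.

Let tD k j : t (k + j) = t k + j%:R * h.
Proof. by rewrite /t /u /h natrD mulrnDl; field; rewrite gt_eqF. Qed.

Let mid_bound : u mid = (odd n)%:R.
Proof.
rewrite /u /mid -mulrnA muln2 uphalf_half doubleD -{3}(odd_double_half n).
by rewrite !natrD -!muln2 !natrM; case: (odd n) => /=; ring.
Qed.

Let midE k : (mid <= k)%N = (0 <= t k).
Proof.
rewrite /t pmulr_lge0 ?invr_gt0// /u subr_ge0 -mulrnA ler_nat muln2.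
by rewrite /mid leq_uphalf_double.
Qed.

(** The condition [y <= t k] says that [k] is at least some [k1], and the first
    lattice point [t k1] overshoots [y] by at most the mesh. *)
Let first_index y : 0 <= y -> exists k1, [/\ (mid <= k1)%N,
  forall k, (y <= t k) = (k1 <= k)%N & t k1 <= y + h].
Proof.
move=> y0; have ex : exists k, y <= t k.
  exists (Num.truncn (y * tau + n%:R)).+1; rewrite /t ler_pdivlMr// /u.
  have := truncnS_gt (y * tau + n%:R); set N := _.+1%:R => H.
  have : 0 <= y * tau by rewrite mulr_ge0// ltW.
  rewrite mulr2n; have := ler0n R n; lra.
have tmono i j : (i <= j)%N -> t i <= t j.
  by move=> ij; rewrite -(subnKC ij) tD lerDl mulr_ge0// ltW.
exists (ex_minn ex); case: ex_minnP => k1 yk1 k1min; split.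
- by rewrite midE (le_trans y0).
- move=> k; apply/idP/idP => [/k1min//|/tmono]; exact: le_trans.
- have [E|lt] := eqVneq k1 mid.
    rewrite E /t mid_bound /h; apply: (@le_trans _ _ (2 / tau)); last by lra.
    by rewrite ler_pM2r ?invr_gt0//; case: odd => /=; lra.
  have m1 : (mid < k1)%N.
    by rewrite ltn_neqAle eq_sym lt midE (le_trans y0).
  have [k1E kk] : k1 = (k1.-1 + 1)%N /\ (k1.-1 < k1)%N by lia.
  rewrite k1E tD mul1r lerD2r leNgt; apply/negP => /ltW /k1min; lia.
Qed.

Let weightE (k : nat) : expR (- (u k ^+ 2) / n%:R) = std_pdf (t k) / normal_peak 1.
Proof.
rewrite /std_pdf mulrAC mulfV ?mul1r ?gt_eqF//; congr expR.
rewrite /t expr_div_n tau2; field; exact: lt0r_neq0.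
Qed.

(** The factor exp(1/n) appears because for odd [n] the middle lattice point is
    u = 1 rather than u = 0. *)
Lemma tail_sum_le y : 0 <= y ->
  \sum_(k < n.+1 | y <= t k) f k <=
  A * expR (n%:R^-1) * (std_tail y + h * std_pdf y).
Proof.
move=> y0; have [k1 [midk1 k1E _]] := first_index y0.
have A0 : 0 <= A by rewrite divr_ge0// mulr_ge0 ?ltW.
have yk1 : y <= t k1 by rewrite k1E.
have tk1 : 0 <= t k1 := le_trans y0 yk1.
rewrite -(big_mkord (fun k => y <= t k) f).
rewrite (eq_bigl (fun k => true && (k1 <= k)%N)); last by move=> k; rewrite k1E.
rewrite -big_nat_widenl// -{1}[k1]add0n big_addn big_mkord.
apply: (@le_trans _ _ (A * expR (n%:R^-1) *
   \sum_(j < n.+1 - k1) h * std_pdf (t k1 + j%:R * h))).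
  rewrite mulr_sumr; apply: ler_sum => j _; rewrite addnC -tD.
  have jn : (k1 + j <= n)%N by have := ltn_ord j; clear; lia.
  have mid0 : (0 < mid)%N by rewrite /mid; move: n3; clear; lia.
  have nmid : (n <= mid.*2)%N by rewrite /mid; clear; lia.
  have kE : (mid + (k1 + j - mid) = k1 + j)%N.
    by rewrite subnKC// (leq_trans midk1) ?leq_addr.
  have := weight_le f0 bal mid0 nmid; move/(_ (k1 + j - mid)%N).
  rewrite kE => /(_ jn) /le_trans; apply; rewrite -/(u _) -/(u _).
  have -> : - (u (k1 + j) ^+ 2 - u mid ^+ 2) / n%:R =
     - (u (k1 + j) ^+ 2) / n%:R + u mid ^+ 2 / n%:R by ring.
  rewrite expRD weightE.
  rewrite [leRHS](_ : _ = f mid * (std_pdf (t (k1 + j)) / normal_peak 1 * expR n%:R^-1)).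
    apply: ler_wpM2l => //; apply: ler_wpM2l.
      by apply: divr_ge0; [exact: std_pdf_ge0|exact: ltW].
    rewrite ler_expR mid_bound; case: (odd n) => /=; first by rewrite expr1n mul1r.
    by rewrite expr0n mul0r invr_ge0 ltW.
  by rewrite /A; field; rewrite !gt_eqF.
apply: ler_wpM2l; first by rewrite mulr_ge0 ?expR_ge0.
apply: (le_trans (riemann_sum_le _ tk1 (ltW h0))).
apply: lerD; first exact: std_tail_le.
by apply: ler_wpM2l; [exact: ltW|exact: std_pdf_le].
Qed.

(** Only lattice points below [Y] are kept, where the correction t^4/(4n) is at
    most Y^4/(4n); the hypothesis on [Y] keeps them inside the range of
    [weight_ge]. *)
Lemma tail_sum_ge y Y : 0 <= y -> 0 <= Y -> 3 * (Y * tau) <= 2 * n%:R ->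
  A * expR (- (Y ^+ 4 / (4 * n%:R))) * (std_tail y - h * std_pdf y - std_tail Y)
  <= \sum_(k < n.+1 | y <= t k) f k.
Proof.
move=> y0 Y0 Yn; have [k1 [midk1 k1E tk1y]] := first_index y0.
have A0 : 0 <= A by rewrite divr_ge0// mulr_ge0 ?ltW.
have yk1 : y <= t k1 by rewrite k1E.
have tk1 : 0 <= t k1 := le_trans y0 yk1.
have [k2 [_ k2E _]] := first_index Y0.
pose m := (k2 - k1)%N.
have tY : Y <= t (k1 + m) by rewrite k2E -maxnE leq_maxr.
have small j : (j < m)%N -> t (k1 + j) <= Y.
  by move=> jm; apply/ltW; rewrite ltNge k2E -ltnNge -ltn_subRL.
have u3 j : (j < m)%N -> 3 * u (k1 + j) <= 2 * n%:R.
  move=> /small; rewrite /t ler_pdivrMr// => ?; lra.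
have jn j : (j < m)%N -> (k1 + j <= n)%N.
  move=> /u3; rewrite /u -mulrnA mulrBr lerBlDr -!natrM -natrD ler_nat.
  by clear; lia.
rewrite -(big_mkord (fun k => y <= t k) f).
rewrite (eq_bigl (fun k => true && (k1 <= k)%N)); last by move=> k; rewrite k1E.
rewrite -big_nat_widenl//.
apply: (@le_trans _ _ (\sum_(j < m) f (k1 + j)%N)); last first.
  have [->|mp] := posnP m; first by rewrite big_ord0 sumr_ge0.
  have kmn : (k1 + m <= n.+1)%N.
    by have := jn m.-1; rewrite prednK// => /(_ (leqnn _)); move: mp; clear; lia.
  rewrite (@big_cat_nat _ _ _ (k1 + m))//= ?leq_addr//.
  rewrite -{2}[k1]add0n big_addn addKn big_mkord.
  under eq_bigr do rewrite addnC.
  by rewrite lerDl sumr_ge0.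
apply: (@le_trans _ _ (A * expR (- (Y ^+ 4 / (4 * n%:R))) *
   \sum_(j < m) h * std_pdf (t k1 + j%:R * h))).
  apply: ler_wpM2l; first by rewrite mulr_ge0 ?expR_ge0.
  apply: le_trans (riemann_sum_ge _ tk1 (ltW h0)).
  rewrite -tD; apply: lerB; last exact: std_tail_le.
  apply: le_trans (std_tail_le tk1y).
  have yh : y <= y + h by rewrite lerDl ltW.
  have := std_tail_lip y0 yh; rewrite (_ : y + h - y = h); last by ring.
  lra.
rewrite mulr_sumr; apply: ler_sum => j _; rewrite -tD.
have jm := ltn_ord j.
have mid0 : (0 < mid)%N by rewrite /mid; move: n3; clear; lia.
have nmid : (n <= mid.*2)%N by rewrite /mid; clear; lia.
have kE : (mid + (k1 + j - mid) = k1 + j)%N.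
    by rewrite subnKC// (leq_trans midk1) ?leq_addr.
have := weight_ge f0 bal mid0 nmid; move/(_ (k1 + j - mid)%N).
rewrite kE => /(_ (jn _ jm) (u3 _ jm)); apply: le_trans; rewrite -/(u (k1 + j)%N).
rewrite opprD expRD -[- (_ / n%:R)]mulNr weightE.
rewrite [leLHS](_ : _ = f mid * (std_pdf (t (k1 + j)) / normal_peak 1
   * expR (- (Y ^+ 4 / (4 * n%:R))))); last by rewrite /A; field; rewrite !gt_eqF.
apply: ler_wpM2l => //; apply: ler_wpM2l.
  by apply: divr_ge0; [exact: std_pdf_ge0|exact: ltW].
rewrite ler_expR lerN2.
have -> : u (k1 + j) ^+ 4 / n%:R ^+ 3 = t (k1 + j) ^+ 4 / (4 * n%:R).
  rewrite /t expr_div_n (_ : tau ^+ 4 = (tau ^+ 2) ^+ 2); last by rewrite -exprM.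
  by rewrite tau2; field; rewrite gt_eqF.
rewrite ler_pM2r ?invr_gt0 ?mulr_gt0//.
by apply: lerXn2r; rewrite ?nnegrE// ?small// -midE (leq_trans midk1) ?leq_addr.
Qed.

End tail_sums.

(** * The errors are O((1 + x^3) / sqrt n) *)

(** Here [s] plays the role of sqrt n and [tau] that of sqrt (n/2); [x] is the
    argument of the statement and [y] its value after the standard deviation has
    been replaced by [tau]. *)
Section tail_asymptotics.
Variables (R : realType) (s tau : R).
Hypotheses (s27 : 27 <= s) (t0 : 0 < tau) (t2 : tau ^+ 2 = s ^+ 2 / 2).
Implicit Types x y : R.

Local Notation K := (expR 3 : R).
Local Notation err x := ((1 + x ^+ 3) / s).

Let s0 : 0 < s. Proof. by have := s27; lra. Qed.
Let K1 : 1 <= K. Proof. by rewrite -expR0 ler_expR. Qed.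
Let K0 : 0 <= K. Proof. exact: expR_ge0. Qed.

Let le_cube x : 0 <= x -> x <= 1 + x ^+ 3.
Proof.
move=> x0; have [x1|x1] := leP x 1.
  by have := exprn_ge0 3 x0; lra.
have : x * 1 <= x * x ^+ 2 by rewrite ler_wpM2l// expr_ge1// ltW.
by rewrite mulr1 -exprS; lra.
Qed.

Let triple_le x : 0 <= x -> x ^+ 3 <= s -> 3 * x <= s.
Proof.
move=> x0 x3; rewrite leNgt; apply/negP => sx.
have x9 : 9 < x by have := s27; lra.
have : 81 * x <= x ^+ 3 by rewrite exprSr ler_wpM2r//; nra.
have := s0; lra.
Qed.

Let err_ge x : 0 <= x -> s^-1 <= err x.
Proof.
move=> x0; rewrite ler_peMl ?invr_ge0 ?(ltW s0)//.
by rewrite lerDl exprn_ge0.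
Qed.

Let err_le2 x : 0 <= x -> x ^+ 3 <= s -> err x <= 2.
Proof. by move=> x0 x3; rewrite ler_pdivrMr//; have := s27; lra. Qed.

Let err_linear x : 0 <= x -> (1 + x) / s <= 2 * (err x).
Proof.
move=> x0; rewrite mulrA ler_pM2r ?invr_gt0//.
by have := le_cube x0; have := exprn_ge0 3 x0; lra.
Qed.

Variables (x y : R).
Hypotheses (x0 : 0 <= x) (x3 : x ^+ 3 <= s) (y0 : 0 <= y) (yx : y <= x)
  (xy : x - y <= x / s ^+ 2) (xy2 : x ^+ 2 - y ^+ 2 <= x ^+ 2 / s ^+ 2).

Let xs : x <= s. Proof. by have := triple_le x0 x3; have := x0; lra. Qed.

Let pdf_y : std_pdf y <= K * (1 + x) * std_tail x.
Proof.
have H : std_pdf y <= expR 1 * std_pdf x.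
  rewrite /std_pdf mulrCA ler_pM2l ?normal_peak_gt0 ?oner_eq0//.
  rewrite -expRD ler_expR.
  have : x ^+ 2 / s ^+ 2 <= 1.
    by rewrite ler_pdivrMr ?exprn_gt0// mul1r lerXn2r ?nnegrE// ltW.
  by have := xy2; lra.
apply: (le_trans H).
have -> : K = expR 1 * expR 2 by rewrite -expRD; congr expR; ring.
by rewrite -2!mulrA ler_pM2l ?expR_gt0// mulrA std_pdf_le_tail.
Qed.

(** The error is (x-y) density(y), at most K x(1+x)/s^2 times the tail at [x];
    one power of s cancels against [x <= s]. *)
Let tail_y : std_tail y <= std_tail x * (1 + 2 * K * err x).
Proof.
have := std_tail_lip y0 yx; have T0 := std_tail_ge0 x.
have H : (x - y) * std_pdf y <= x / s ^+ 2 * (K * (1 + x) * std_tail x).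
  by apply: ler_pM; rewrite ?subr_ge0 ?std_pdf_ge0.
have H2 : x / s ^+ 2 * (1 + x) <= 2 * err x.
  apply: le_trans (err_linear x0).
  have -> : x / s ^+ 2 * (1 + x) = (x / s) * ((1 + x) / s).
    by field; rewrite gt_eqF.
  rewrite ler_piMl ?divr_ge0 ?(ltW s0)//; first by have := x0; lra.
  by rewrite ler_pdivrMr// mul1r.
have H3 : x / s ^+ 2 * (K * (1 + x) * std_tail x) <= 2 * K * err x * std_tail x.
  rewrite [leLHS](_ : _ = (x / s ^+ 2 * (1 + x)) * (K * std_tail x)); last by ring.
  rewrite [leRHS](_ : _ = 2 * err x * (K * std_tail x)); last by ring.
  by rewrite ler_wpM2r// mulr_ge0.
by rewrite mulrDr mulr1 [_ * (2 * K * _)]mulrC; lra.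
Qed.

(** The mesh 2/tau = sqrt 8 / s is at most 3/s. *)
Lemma lattice_term_le : 2 / tau * std_pdf y <= 6 * K * err x * std_tail x.
Proof.
have T0 := std_tail_ge0 x.
have h3 : 2 / tau <= 3 / s.
  rewrite ler_pdivrMr// mulrAC ler_pdivlMr//.
  rewrite -ler_sqr ?nnegrE ?mulr_ge0 ?(ltW s0) ?(ltW t0)//.
  by rewrite !exprMn t2; have := sqr_ge0 s; lra.
apply: (@le_trans _ _ (3 / s * (K * (1 + x) * std_tail x))).
  by apply: ler_pM; rewrite ?std_pdf_ge0// divr_ge0// ltW.
rewrite [leLHS](_ : _ = (1 + x) / s * (3 * K * std_tail x)); last by ring.
rewrite [leRHS](_ : _ = 2 * err x * (3 * K * std_tail x)); last by ring.
by rewrite ler_wpM2r ?err_linear// !mulr_ge0.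
Qed.

Lemma smoothed_tail_le :
  expR (s ^+ 2)^-1 * (std_tail y + 2 / tau * std_pdf y)
  <= (1 + 42 * K * err x) * std_tail x.
Proof.
have T0 := std_tail_ge0 x; have T1 := tail_y; have T2 := lattice_term_le.
have S27 := s27; have S0 := s0; have KK := K1.
have E0 := err_ge x0; have E2 := err_le2 x0 x3.
have i0 : 0 < s^-1 by rewrite invr_gt0.
have i1 : s^-1 <= 1 / 27 by rewrite div1r lef_pV2 ?posrE.
have e1 : expR (s ^+ 2)^-1 <= 1 + 2 * err x.
  have z : (s ^+ 2)^-1 <= s^-1 by rewrite -exprVn; nra.
  apply: (@le_trans _ _ (expR s^-1)); first by rewrite ler_expR.
  have := expR_ge1Dx (- s^-1); rewrite expRN => H.
  have p : 0 < expR s^-1 by exact: expR_gt0.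
  have : expR s^-1 * (1 - s^-1) <= 1.
    by rewrite -[leRHS](mulfV (lt0r_neq0 p)) ler_pM2l.
  set e := expR _; set i := s^-1 in i0 i1 E0 *; move=> ei.
  suff : e <= 1 + 2 * i by lra.
  have i1' : 0 < 1 - i by lra.
  by rewrite -(ler_pM2r i1'); have := mulr_gt0 i0 i1'; nra.
set E := err x in T1 T2 E0 E2 e1 *.
apply: (@le_trans _ _ ((1 + 2 * E) * ((1 + 8 * K * E) * std_tail x))).
  apply: ler_pM => //.
    by rewrite addr_ge0 ?std_tail_ge0// mulr_ge0 ?std_pdf_ge0// divr_ge0// ltW.
  by lra.
rewrite mulrA ler_wpM2r//.
have : E * E <= E * 2 by rewrite ler_wpM2l//; lra.
have : E <= K * E by rewrite ler_peMl//; lra.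
move=> H1 /(ler_wpM2l K0); lra.
Qed.

(** The cutoff is Y = x + r with r^4 = s, that is r = n^(1/8).  The tail beyond
    [Y] is at most exp(-r^2/2) <= 16/s times the tail at [x], while
    Y^4 <= 8 (x^4 + s) and x^4 <= x^3 s give Y^4/(4 s^2) <= 2 (1+x^3)/s. *)
Lemma smoothed_tail_ge : exists Y, [/\ 0 <= Y, 3 * (Y * tau) <= 2 * s ^+ 2 &
  (1 - 42 * K * err x) * std_tail x <=
  expR (- (Y ^+ 4 / (4 * s ^+ 2))) * (std_tail y - 2 / tau * std_pdf y - std_tail Y)].
Proof.
have T0 := std_tail_ge0 x; have T2 := lattice_term_le.
have S27 := s27; have S0 := s0; have KK := K1; have X0 := x0; have X3 := x3.
have E0 := err_ge x0; have E2 := err_le2 x0 x3.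
have i0 : 0 < s^-1 by rewrite invr_gt0.
pose q := Num.sqrt s; pose r := Num.sqrt q.
have q0 : 0 < q by rewrite sqrtr_gt0.
have r0 : 0 < r by rewrite sqrtr_gt0.
have q2 : q ^+ 2 = s by rewrite sqr_sqrtr// ltW.
have r2 : r ^+ 2 = q by rewrite sqr_sqrtr// ltW.
have r4 : r ^+ 4 = s by rewrite -q2 -r2 -exprM.
have r3s : 3 * r <= s.
  apply: triple_le; first exact: ltW.
  have r1 : 1 <= r.
    rewrite leNgt; apply/negP => r1; have : r ^+ 4 <= 1 by rewrite exprn_ile1// ltW.
    by rewrite r4; lra.
  by rewrite -[leRHS]r4 [leRHS]exprS ler_peMl// exprn_ge0// ltW.
have ts : tau <= s.
  rewrite -ler_sqr ?nnegrE ?(ltW s0) ?(ltW t0)// t2.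
  by have := sqr_ge0 s; lra.
exists (x + r); split.
- by rewrite addr_ge0// ltW.
- have x3s := triple_le x0 x3.
  apply: (@le_trans _ _ (3 * ((x + r) * s))).
    by rewrite ler_pM2l// ler_wpM2l// addr_ge0// ltW.
  rewrite mulrA expr2 mulrA ler_pM2r//; lra.
set Y := x + r.
have Y4 : Y ^+ 4 / (4 * s ^+ 2) <= 2 * err x.
  have H : Y ^+ 4 <= 8 * (x ^+ 4 + r ^+ 4).
    have H2 : (x + r) ^+ 2 <= 2 * (x ^+ 2 + r ^+ 2).
      by have := sqr_ge0 (x - r); lra.
    have : ((x + r) ^+ 2) ^+ 2 <= (2 * (x ^+ 2 + r ^+ 2)) ^+ 2.
      by rewrite lerXn2r// nnegrE ?sqr_ge0// mulr_ge0// addr_ge0// sqr_ge0.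
    by have := sqr_ge0 (x ^+ 2 - r ^+ 2); rewrite /Y; lra.
  have x4 : x ^+ 4 <= x ^+ 3 * s by rewrite exprSr ler_wpM2l// exprn_ge0.
  rewrite ler_pdivrMr ?mulr_gt0 ?exprn_gt0//.
  rewrite [leRHS](_ : _ = 8 * ((1 + x ^+ 3) * s)); last by field; rewrite gt_eqF.
  by rewrite r4 in H; lra.
have TY : std_tail Y <= 16 * err x * std_tail x.
  apply: (le_trans (std_tail_shift x0 (ltW r0))); rewrite r2 ler_wpM2r//.
  apply: (@le_trans _ _ (16 * s^-1)); last by lra.
  (* exp(-q/2) is the inverse square of exp(q/4) >= q/4, and q^2 = s. *)
  have e : 1 + q / 4 <= expR (q / 4) by exact: expR_ge1Dx.
  have -> : - q / 2 = - (q / 4 + q / 4) by field.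
  rewrite expRN expRD.
  have p4 : 0 < q / 4 by rewrite divr_gt0.
  have : (q / 4) * (q / 4) <= expR (q / 4) * expR (q / 4).
    by apply: ler_pM; rewrite ?(ltW p4)//; lra.
  have -> : 16 * s^-1 = ((q / 4) * (q / 4))^-1.
    by rewrite -q2; field; rewrite gt_eqF.
  by rewrite lef_pV2 // posrE mulr_gt0 ?expR_gt0.
have TT := std_tail_le yx.
set E := err x in T2 E0 E2 Y4 TY *.
have EK : E <= K * E by rewrite ler_peMl//; lra.
pose B := 1 - (6 * K + 16) * E.
have HB : B * std_tail x <= std_tail y - 2 / tau * std_pdf y - std_tail Y.
  by rewrite /B; lra.
set e := expR (- _).
have e0 : 0 < e by exact: expR_gt0.
have e1 : e <= 1.
  rewrite -[leRHS]expR0 ler_expR oppr_le0 divr_ge0//.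
    by rewrite exprn_ge0// addr_ge0// ltW.
  by rewrite mulr_ge0// sqr_ge0.
have e2 : 1 - 2 * E <= e.
  by apply: le_trans (expR_ge1Dx _); lra.
apply: (@le_trans _ _ (e * (B * std_tail x))); last by rewrite ler_pM2l.
rewrite [leRHS]mulrA ler_wpM2r//.
have B1 : 1 - 42 * K * E <= B - 2 * E by rewrite /B; lra.
have B2 : B <= 1.
  have E00 : 0 <= E by lra.
  by rewrite lerBlDr lerDl mulr_ge0// addr_ge0// mulr_ge0.
apply: (le_trans B1).
(* Multiplying by [e], which lies between 1 - 2E and 1, lowers [B] by at most 2E
   when [B] is in [0, 1] and raises it when [B] is negative. *)
have [Bn|Bp] := leP B 0.
  have : B <= e * B by nra.
  lra.
have : (1 - 2 * E) * B <= e * B by rewrite ler_wpM2r// ltW.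
have : E * B <= E by rewrite ler_piMr//; lra.
lra.
Qed.

End tail_asymptotics.

(** * Normalization *)

Section half_mass.
Variables (R : realType) (n : nat) (f : nat -> R).
Hypotheses (f0 : forall k, 0 <= f k) (fsum : \sum_(k < n.+1) f k = 1)
  (fsym : forall k, (k <= n)%N -> f (n - k) = f k).

Let S : R := \sum_(k < n.+1 | (n <= k.*2)%N) f k.
Let D : R := \sum_(k < n.+1 | n == k.*2) f k.

(** The reflection k -> n - k exchanges the two open halves, so counting the closed
    upper half twice counts only the centre in excess. *)
Let twice_half : S + S = 1 + D.
Proof.
have lower : \sum_(k < n.+1 | ~~ (n <= k.*2)%N) f k =
    \sum_(k < n.+1 | (n < k.*2)%N) f k.
  rewrite (reindex_inj rev_ord_inj)/=; apply: eq_big => [k|k _].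
    by rewrite subSS -ltnNge; have := ltn_ord k; move: (val k) => m; clear; lia.
  by rewrite subSS fsym// -ltnS.
have upper : S = \sum_(k < n.+1 | (n < k.*2)%N) f k + D.
  rewrite /S (bigID (fun k : 'I_n.+1 => n == k.*2))/= addrC; congr (_ + _).
    by apply: eq_bigl => k; rewrite ltn_neqAle andbC.
  by apply: eq_bigl => k; move: (nat_of_ord k) => m; apply/idP/idP; clear; lia.
rewrite -fsum (bigID (fun k : 'I_n.+1 => (n <= k.*2)%N))/= lower -/S.
by rewrite -addrA -upper.
Qed.

Lemma half_mass_ge : 2^-1 <= S.
Proof.
have : 0 <= D by apply: sumr_ge0.
by have := twice_half; lra.
Qed.

Lemma half_mass_le : S <= 2^-1 + f (uphalf n) / 2.
Proof.
suff : D <= f (uphalf n) by have := twice_half; lra.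
rewrite /D; have [nodd|neven] := boolP (odd n).
  rewrite big_pred0// => k; apply/eqP => nk.
  by move: nodd; rewrite nk odd_double.
have mn : (uphalf n < n.+1)%N by clear; lia.
rewrite (bigD1 (Ordinal mn))/=; last by move: neven; clear; lia.
rewrite big1 ?addr0// => k /andP[/eqP nk]; rewrite -val_eqE/=.
by move/eqP; case; move: nk; move: (val k) => m; clear; lia.
Qed.

End half_mass.

(** The first two bounds, at the origin, pin [A] to 1 + O(C e); the last two then
    transfer this to the ratio.  [T] is the normal tail, [P] the probability,
    [e] and [E] the error scales at the origin and at [x]. *)
Lemma ratio_from_bounds (R : realType) (C e E A T P : R) :
  0 <= C -> 0 <= e -> e <= E -> 6 * (C * e) <= 1 -> 0 <= A -> 0 < T ->
  2^-1 <= A * ((1 + C * e) * 2^-1) ->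
  A * ((1 - C * e) * 2^-1) <= 2^-1 + A * (C * e) / 2 ->
  P <= A * ((1 + C * E) * T) -> A * ((1 - C * E) * T) <= P ->
  `|P / T - 1| <= 8 * C * E.
Proof.
move=> C0 e0 eE small A0 T0 H1 H2 H3 H4.
have CeE : C * e <= C * E by rewrite ler_wpM2l.
have Ce0 : 0 <= C * e by rewrite mulr_ge0.
have -> : 8 * C * E = 8 * (C * E) by ring.
move: (C * e) (C * E) small H1 H2 H3 H4 CeE Ce0 => z Z small H1 H2 H3 H4 zZ z0.
have Alo : 1 - z <= A.
  by nra.
have Ahi : A <= 1 + 3 * z by nra.
have Z0 : 0 <= Z by lra.
rewrite ler_norml; apply/andP; split.
  rewrite lerBrDr ler_pdivlMr//; apply: le_trans H4 => /=.
  rewrite mulrA ler_wpM2r ?(ltW T0)//.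
  by have [Z1|Z1] := leP Z 1; nra.
rewrite lerBlDr ler_pdivrMr//; apply: (le_trans H3).
rewrite mulrA ler_wpM2r ?(ltW T0)//.
nra.
Qed.

(** * From the random configuration to lattice sums *)

Lemma variance_spin_sum (R : realType) (n : nat) (p : n.-tuple bool -> R)
    (d : measure_display) (T : measurableType d) (P : probability T R)
    (X : {RV P >-> n.-tuple bool}) :
  (3 <= n)%N -> antivoter_stationary p ->
  (forall s, distribution P X [set s] = (p s)%:E) ->
  fine 'V_P[fun w => ((pluses (X w))%:R *+ 2 - n%:R)%R]%E =
  n%:R * (n%:R - 2) / (n%:R *+ 2 - 3).
Proof.
move=> n3 pstat lawX; pose g (s : n.-tuple bool) : R := (pluses s)%:R *+ 2 - n%:R.
rewrite /variance unlock (expectation_finite lawX g) (mean_spin_sum n3 pstat)/=.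
rewrite [X in 'E_P[X]%E](_ : _ = fun w => (fun s => g s ^+ 2) (X w)); last first.
  apply/funext => w; change ((g (X w) - 0) * (g (X w) - 0) = g (X w) ^+ 2).
  by rewrite subr0 expr2.
rewrite (expectation_finite lawX (fun s => g s ^+ 2)).
by rewrite (second_moment_spin_sum n3 pstat).
Qed.

Lemma tail_probability_law (R : realType) (n : nat) (p : n.-tuple bool -> R)
    (d : measure_display) (T : measurableType d) (P : probability T R)
    (X : {RV P >-> n.-tuple bool}) (Q : pred nat) :
  (forall s, distribution P X [set s] = (p s)%:E) ->
  fine (P [set w | Q (pluses (X w))]) = \sum_(k < n.+1 | Q k) plus_law p k.
Proof.
move=> lawX; rewrite (probability_finite lawX (fun s => Q (pluses s))).
have := sum_plus_law p (fun k => (Q k)%:R).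
have toR (I : finType) (F : I -> R) (q : pred I) :
    \sum_i F i * (q i)%:R = \sum_(i | q i) F i.
  rewrite [RHS]big_mkcond; apply: eq_bigr => i _.
  by case: (q i); rewrite ?mulr1 ?mulr0.
by rewrite (toR _ p (fun s => Q (pluses s))) (toR _ _ (fun k : 'I__ => Q k)).
Qed.

Section rescaling.
Variables (R : realType) (n : nat).
Hypothesis n3 : (3 <= n)%N.
Let tau : R := Num.sqrt (n%:R / 2).
Let sigma : R := Num.sqrt (n%:R * (n%:R - 2) / (n%:R *+ 2 - 3)).

Let N3 : 3 <= n%:R :> R. Proof. by rewrite ler_nat. Qed.

(** Since sigma^2/tau^2 = 1 - 1/(2n-3), replacing sigma by tau decreases x^2 by
    x^2/(2n-3). *)
Lemma rescale_bounds (x : R) : 0 <= x ->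
  let y := x * (sigma / tau) in
  [/\ 0 < sigma, 0 <= y, y <= x, x - y <= x / n%:R
    & x ^+ 2 - y ^+ 2 <= x ^+ 2 / n%:R].
Proof.
move=> x0 y; have N := N3; set m : R := n%:R in N *.
have p1 : 0 < m *+ 2 - 3 by rewrite mulr2n; lra.
have s2pos : 0 < m * (m - 2) / (m *+ 2 - 3) by rewrite divr_gt0// mulr_gt0//; lra.
have s0 : 0 < sigma by rewrite sqrtr_gt0.
have t0 : 0 < tau by rewrite sqrtr_gt0 divr_gt0//; lra.
have s2 : sigma ^+ 2 = m * (m - 2) / (m *+ 2 - 3) by rewrite sqr_sqrtr// ltW.
have t2 : tau ^+ 2 = m / 2 by rewrite sqr_sqrtr// divr_ge0//; lra.
have y0 : 0 <= y by rewrite mulr_ge0// divr_ge0// ltW.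
have y2 : y ^+ 2 = x ^+ 2 - x ^+ 2 / (m *+ 2 - 3).
  rewrite /y exprMn expr_div_n s2 t2; field.
  by rewrite !gt_eqF//; lra.
have x2 : 0 <= x ^+ 2 by exact: sqr_ge0.
have q : x ^+ 2 / (m *+ 2 - 3) <= x ^+ 2 / m.
  by rewrite ler_wpM2l// lef_pV2 ?posrE//; [rewrite mulr2n; lra|lra].
have q0 : 0 <= x ^+ 2 / (m *+ 2 - 3) by rewrite divr_ge0// ltW.
have yx : y <= x by rewrite -ler_sqr ?nnegrE// y2; lra.
split => //; last by rewrite y2; lra.
move: x0; rewrite le_eqVlt => /predU1P[x0|x0].
  by rewrite /y -x0 !mul0r subrr.
rewrite -(ler_pM2r x0) mulrAC -expr2.
have : (x - y) * x <= (x - y) * (x + y) by rewrite ler_wpM2l ?subr_ge0// lerDl.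
by rewrite -subr_sqr y2; lra.
Qed.

End rescaling.

(** The lower bound 252 exp 3 on sqrt n makes six times the error at the origin,
    6 * 42 exp 3 / sqrt n, at most 1, as [ratio_from_bounds] requires. *)
Section large_graphs.
Variables (R : realType) (n : nat) (p : n.-tuple bool -> R).
Hypotheses (n729 : (729 <= n)%N) (nK : 252 * expR 3 <= Num.sqrt n%:R :> R)
  (pstat : antivoter_stationary p).
Let tau : R := Num.sqrt (n%:R / 2).

Lemma tail_ratio_large (x y : R) : 0 <= x -> x ^+ 3 <= Num.sqrt n%:R ->
  0 <= y -> y <= x -> x - y <= x / n%:R ->
  x ^+ 2 - y ^+ 2 <= x ^+ 2 / n%:R ->
  `| (\sum_(k < n.+1 | y <= (k%:R *+ 2 - n%:R) / tau) plus_law p k) / std_tail x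
     - 1 | <= 8 * (42 * expR 3) * ((1 + x ^+ 3) / Num.sqrt n%:R).
Proof.
have n3 : (3 <= n)%N by apply: leq_trans n729.
have np : 0 < n%:R :> R by rewrite ltr0n; apply: leq_trans n3.
have s2 : Num.sqrt n%:R ^+ 2 = n%:R :> R by rewrite sqr_sqrtr// ltW.
have s27 : 27 <= Num.sqrt n%:R :> R.
  have -> : 27 = Num.sqrt (27 ^+ 2) :> R by rewrite sqrtr_sqr ger0_norm.
  by rewrite ler_sqrt ?(ltW np)// -natrX ler_nat.
have t0 : 0 < tau by rewrite sqrtr_gt0 divr_gt0.
have t2 : tau ^+ 2 = Num.sqrt n%:R ^+ 2 / 2.
  by rewrite s2 sqr_sqrtr// ltW// divr_gt0.
have c0 : 0 < normal_peak 1 :> R by rewrite normal_peak_gt0 ?oner_eq0.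
have f0 := plus_law_ge0 pstat; have bal := plus_law_balance n3 pstat.
pose A := plus_law p (uphalf n) / (2 / tau * normal_peak 1).
have A0 : 0 <= A by rewrite divr_ge0// mulr_ge0 ?divr_ge0 ?ltW.
pose F y := \sum_(k < n.+1 | y <= (k%:R *+ 2 - n%:R) / tau) plus_law p k.
have up x' y' : 0 <= x' -> x' ^+ 3 <= Num.sqrt n%:R -> 0 <= y' -> y' <= x' ->
    x' - y' <= x' / n%:R -> x' ^+ 2 - y' ^+ 2 <= x' ^+ 2 / n%:R ->
    F y' <= A * ((1 + 42 * expR 3 * ((1 + x' ^+ 3) / Num.sqrt n%:R)) * std_tail x').
  move=> x0 x3 y0 yx d1 d2.
  apply: (le_trans (tail_sum_le n3 f0 bal y0)); rewrite -[leLHS]mulrA ler_wpM2l//.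
  have := @smoothed_tail_le _ _ _ s27 t0 t2 x' y' x0 x3 y0 yx.
  by rewrite s2; exact.
have low x' y' : 0 <= x' -> x' ^+ 3 <= Num.sqrt n%:R -> 0 <= y' -> y' <= x' ->
    x' - y' <= x' / n%:R -> x' ^+ 2 - y' ^+ 2 <= x' ^+ 2 / n%:R ->
    A * ((1 - 42 * expR 3 * ((1 + x' ^+ 3) / Num.sqrt n%:R)) * std_tail x') <= F y'.
  move=> x0 x3 y0 yx d1 d2.
  have := @smoothed_tail_ge _ _ _ s27 t0 t2 x' y' x0 x3 yx.
  rewrite s2 => /(_ d2) [Y [Y0 Yn H]].
  apply: le_trans (tail_sum_ge n3 f0 bal y0 Y0 Yn).
  by rewrite -[leRHS]mulrA ler_wpM2l.
have F0 : F 0 = \sum_(k < n.+1 | (n <= k.*2)%N) plus_law p k.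
  apply: eq_bigl => k; rewrite pmulr_lge0 ?invr_gt0// subr_ge0 -mulrnA.
  by rewrite ler_nat muln2.
have O3 : (0 : R) ^+ 3 <= Num.sqrt n%:R by rewrite expr0n sqrtr_ge0.
have Od : (0 : R) - 0 <= 0 / n%:R by rewrite mul0r subr0.
have O2 : (0 : R) ^+ 2 - 0 ^+ 2 <= 0 ^+ 2 / n%:R by rewrite subrr expr0n mul0r.
move=> x0 x3 y0 yx d1 d2.
have T0 := std_tail_gt0 x0.
have e0 : 0 < (Num.sqrt n%:R)^-1 :> R by rewrite invr_gt0 sqrtr_gt0.
have E0 : (1 + 0 ^+ 3) / Num.sqrt n%:R = (Num.sqrt n%:R)^-1 :> R.
  by rewrite expr0n addr0 div1r.
have K0 : 0 <= expR 3 :> R by exact: expR_ge0.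
apply: (@ratio_from_bounds _ _ (Num.sqrt n%:R)^-1 _ A) => //.
- by rewrite ler_peMl ?(ltW e0)// lerDl exprn_ge0.
- rewrite mulrA ler_pdivrMr ?sqrtr_gt0// mul1r; have := nK; lra.
- have := up 0 0 (lexx _) O3 (lexx _) (lexx _) Od O2.
  rewrite E0 std_tail0; apply: le_trans; rewrite F0.
  exact: half_mass_ge f0 (plus_law_sum1 pstat) (plus_law_sym n3 pstat).
- have := low 0 0 (lexx _) O3 (lexx _) (lexx _) Od O2.
  rewrite E0 std_tail0 => /le_trans; apply; rewrite F0.
  apply: le_trans (half_mass_le f0 (plus_law_sum1 pstat) (plus_law_sym n3 pstat)) _.
  rewrite lerD2l ler_pM2r//.
  have -> : plus_law p (uphalf n) = A * (2 / tau * std_pdf 0).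
    rewrite /A /std_pdf expr0n oppr0 mul0r expR0 mulr1 divfK// gt_eqF// mulr_gt0//.
    by rewrite divr_gt0.
  rewrite ler_wpM2l//.
  have := @lattice_term_le _ _ _ s27 t0 t2 0 0 (lexx _) O3.
  rewrite s2 => /(_ O2); rewrite E0 std_tail0 => /le_trans; apply.
  by have := mulr_ge0 K0 (ltW e0); lra.
- exact: up.
- exact: low.
Qed.

End large_graphs.

Theorem proposition4p1 (R : realType) :
  exists C : R, forall (n : nat), (3 <= n)%N ->
  forall (p : n.-tuple bool -> R), antivoter_stationary p ->
  forall (d : measure_display) (T : measurableType d) (P : probability T R)
         (X : {RV P >-> n.-tuple bool}),
  (forall s : n.-tuple bool, distribution P X [set s] = (p s)%:E) ->
  let U : T -> R := fun w => \sum_(i < n) spin R (tnth (X w) i) in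
  let sigma : R := Num.sqrt (fine 'V_P[U]%E) in
  let W : T -> R := fun w => U w / sigma in
  forall x : R, 0 <= x -> x <= n%:R `^ (6%:R^-1) ->
  `| fine (P [set w | x <= W w]) / (1 - std_normal_cdf x) - 1 |
    <= C * ((1 + x ^+ 3) / Num.sqrt n%:R).
Proof.
pose N0 := (Num.truncn ((252 * expR 3) ^+ 2 : R) + 729)%N.
have T0 : 0 < std_tail (N0%:R : R) by exact: std_tail_gt0.
pose C0 : R := N0%:R * ((std_tail N0%:R)^-1 + 1).
have C00 : 0 <= C0 by rewrite mulr_ge0// addr_ge0// invr_ge0 ltW.
have C10 : 0 <= 8 * (42 * expR 3) :> R by rewrite !mulr_ge0// expR_ge0.
exists (C0 + 8 * (42 * expR 3)) => n n3 p pstat d T P X lawX U sigma W x x0 x6.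
have np : 0 < n%:R :> R by rewrite ltr0n; apply: leq_trans n3.
have sn0 : 0 < Num.sqrt n%:R :> R by rewrite sqrtr_gt0.
have err0 : 0 <= (1 + x ^+ 3) / Num.sqrt n%:R.
  by rewrite divr_ge0 ?(ltW sn0)// addr_ge0// exprn_ge0.
have UE : U = fun w => (pluses (X w))%:R *+ 2 - n%:R.
  by apply/funext => w; exact: sum_spin.
rewrite -/(std_tail x).
have x3 : x ^+ 3 <= Num.sqrt n%:R.
  have -> : Num.sqrt n%:R = (n%:R `^ (6%:R^-1)) ^+ 3 :> R.
    rewrite -powR_mulrn ?powR_ge0// -powRrM -powR12_sqrt ?(ltW np)//.
    by congr (_ `^ _); field.
  by rewrite lerXn2r// nnegrE powR_ge0.
(* For n < N0 the ratio is at most 1 / tail(x), hence at most 1 / tail(N0), and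
   the error scale is at least 1 / N0. *)
have [nN|Nn] := ltnP n N0.
  set q := fine _; have q0 : 0 <= q by rewrite fine_ge0.
  have mW : q <= 1.
    rewrite /q (_ : [set w | x <= W w] = [set w | (fun k : nat =>
      x <= (k%:R *+ 2 - n%:R) / sigma) (pluses (X w))]); last first.
      by apply/seteqP; split => w /=; rewrite /W UE.
    rewrite (tail_probability_law (fun k => x <= (k%:R *+ 2 - n%:R) / sigma) lawX).
    have := plus_law_sum1 pstat.
    rewrite (bigID (fun k : 'I_n.+1 => x <= (k%:R *+ 2 - n%:R) / sigma))/= => S1.
    by rewrite -[leRHS]S1 lerDl sumr_ge0// => k _; exact: plus_law_ge0.
  have xN : x <= N0%:R.
    have n1 : 1 <= n%:R :> R by rewrite ler1n; apply: leq_trans n3.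
    apply: (le_trans x6); apply: (@le_trans _ _ (n%:R `^ 1)).
      by rewrite ler_powR// invf_le1 ?ler1n.
    by rewrite powRr1 ?(ltW np)// ler_nat ltnW.
  have Tx : std_tail N0%:R <= std_tail x by exact: std_tail_le.
  have Tx0 := lt_le_trans T0 Tx.
  apply: (@le_trans _ _ ((std_tail N0%:R)^-1 + 1)).
    apply: (le_trans (ler_normB _ _)); rewrite normr1 lerD2r.
    rewrite ger0_norm ?divr_ge0 ?(ltW Tx0)//.
    apply: (@le_trans _ _ (1 / std_tail x)); first by rewrite ler_pM2r ?invr_gt0.
    by rewrite div1r lef_pV2 ?posrE.
  apply: (@le_trans _ _ (C0 * (N0%:R)^-1)).
    by rewrite /C0 mulrC mulrA mulVf ?mul1r// pnatr_eq0 /N0 addnS.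
  apply: ler_pM => //.
    by rewrite lerDl.
  rewrite ler_pdivlMr// ler_pdivrMl ?ltr0n ?(leq_trans _ nN)//.
  apply: (@le_trans _ _ (N0%:R * 1)); last by rewrite ler_wpM2l// lerDl exprn_ge0.
  rewrite mulr1; apply: (@le_trans _ _ n%:R); last by rewrite ler_nat ltnW.
  rewrite -[leRHS]sqr_sqrtr ?(ltW np)// expr2 ler_peMl ?(ltW sn0)//.
  by rewrite -[leLHS]sqrtr1 ler_sqrt// ler1n; apply: leq_trans n3.
have n729 : (729 <= n)%N by apply: leq_trans Nn; rewrite leq_addl.
have nK : 252 * expR 3 <= Num.sqrt n%:R :> R.
  rewrite -[leLHS]ger0_norm ?mulr_ge0 ?expR_ge0// -sqrtr_sqr ler_sqrt ?(ltW np)//.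
  apply: ltW; apply: (lt_le_trans (truncnS_gt _)); rewrite ler_nat.
  by apply: leq_trans Nn; rewrite /N0 -[leqLHS]addn1 leq_add2l.
have sigmaE : sigma = Num.sqrt (n%:R * (n%:R - 2) / (n%:R *+ 2 - 3)).
  by rewrite /sigma UE (variance_spin_sum n3 pstat lawX).
have := rescale_bounds n3 x0; rewrite -sigmaE.
set tau := Num.sqrt (n%:R / 2); set y := x * (sigma / tau).
move=> [s0 y0 yx d1 d2].
have t0 : 0 < tau by rewrite sqrtr_gt0 divr_gt0.
apply: (@le_trans _ _ (8 * (42 * expR 3) * ((1 + x ^+ 3) / Num.sqrt n%:R))); last first.
  by rewrite ler_wpM2r// lerDr.
rewrite (_ : [set w | x <= W w] = [set w | (fun k : nat =>
    y <= (k%:R *+ 2 - n%:R) / tau) (pluses (X w))]); last first.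
  apply/seteqP; split => w /=; rewrite /W UE /y;
  by rewrite mulrA ler_pM2r ?invr_gt0// ler_pdivlMr.
rewrite (tail_probability_law (fun k => y <= (k%:R *+ 2 - n%:R) / tau) lawX).
exact: tail_ratio_large.
Qed.
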